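(* Suppose $G:\mathrm{cl}(X\times Y\times Z)\to\mathbb{R}$ is of class $C^1(\mathrm{cl}(X\times Y\times Z))$ and that for each $x\in X$ the map $(y,z)\in \mathrm{cl}(Y\times Z)\mapsto (G_x,G)(x,y,z)\in\mathbb{R}^{m+1}$ is a homeomorphism onto its range, and this range $(G_x,G)(x,\mathrm{cl}(Y\times Z))\subset\mathbb{R}^{m+1}$ is convex. Then the set $\mathcal{U}=\{u:X\to\mathbb{R}\mid u \text{ is } G\text{-convex}\}$ is convex (i.e. $(1-t)u_0+tu_1\in\mathcal{U}$ for all $u_0,u_1\in\mathcal{U}$, $t\in[0,1]$) if and only if for each $x,x_0\in X$ the function $t\in[0,1]\mapsto G(x,y_t,z_t)$ is convex along every $G$-segment $t\mapsto(x_0,y_t,z_t)$.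
   Context: Setting. $m\ge n$; $X\subset\mathbb{R}^m$, $Y\subset\mathbb{R}^n$ are open and bounded; $Z=(\underline z,\bar z)$ with $-\infty<\underline z<\bar z\le+\infty$; $\mathrm{cl}$ denotes closure in Euclidean space. Subscripts denote partial derivatives, e.g. $G_x=(\partial G/\partial x^1,\dots,\partial G/\partial x^m)$. $G\in C^1(\mathrm{cl}(X\times Y\times Z))$ means that all first partial derivatives exist and are continuous. $G$-segments: for $x_0\in X$ and $(y_0,z_0),(y_1,z_1)\in \mathrm{cl}(Y\times Z)$, when for each $x\in X$ the map $(y,z)\in \mathrm{cl}(Y\times Z)\mapsto (G_x,G)(x,y,z)$ is a homeomorphism onto its range and this range is convex, let $(y_t,z_t)\in \mathrm{cl}(Y\times Z)$ be the unique solution of $(G_x,G)(x_0,y_t,z_t)=(1-t)(G_x,G)(x_0,y_0,z_0)+t(G_x,G)(x_0,y_1,z_1)$ for $t\in[0,1]$. The curve $t\in[0,1]\mapsto(x_0,y_t,z_t)$ is called the $G$-segment connecting $(x_0,y_0,z_0)$ and $(x_0,y_1,z_1)$. $G$-convexity: a function $u\in C^0(X)$ is called $G$-convex if for each $x_0\in X$ there exist $y_0\in \mathrm{cl}(Y)$ and $z_0\in \mathrm{cl}(Z)$ such that $u(x_0)=G(x_0,y_0,z_0)$ and $u(x)\ge G(x,y_0,z_0)$ for all $x\in X$. *)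

(* Defs.v *)
From HB Require Import structures.
From mathcomp Require Import all_boot all_order all_algebra.
From mathcomp Require Import interval_inference.
From mathcomp Require Import all_classical all_reals all_analysis.

Set Implicit Arguments.
Unset Strict Implicit.
Unset Printing Implicit Defensive.

Import Order.TTheory GRing.Theory Num.Theory.
Import numFieldNormedType.Exports.

Local Open Scope classical_set_scope.
Local Open Scope ring_scope.

(* Functions on closures of open sets are represented by total functions; every
   notion below depends only on the values of [G] on [closure (X `*` Y `*` Z)]
   and on the values of [u] on [X]. *)

Section GConvexity.
Context {R : realType} {m n : nat}.

Implicit Types (G : 'rV[R]_m * 'rV[R]_n * R^o -> R^o).
Implicit Types (X : set 'rV[R]_m) (Y : set 'rV[R]_n) (Z : set R^o).
Implicit Types (x : 'rV[R]_m) (yz : 'rV[R]_n * R^o).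

Definition dirx (i : 'I_m) : 'rV[R]_m * 'rV[R]_n * R^o := (delta_mx 0 i, 0, 0).
Definition diry (j : 'I_n) : 'rV[R]_m * 'rV[R]_n * R^o := (0, delta_mx 0 j, 0).
Definition dirz : 'rV[R]_m * 'rV[R]_n * R^o := (0, 0, 1).

(* The interval ]zl, zu[ of real numbers, where [zu] may be [+oo]. *)
Definition Zitv (zl : R) (zu : \bar R) : set R^o :=
  [set z : R^o | zl < z /\ (z%:E < zu)%E].

(* [G] has a partial derivative in the direction [e] at every point of the open
   set [Omega], and this derivative extends continuously to [closure Omega]. *)
Definition C1_along (Omega : set ('rV[R]_m * 'rV[R]_n * R^o)) G
    (e : 'rV[R]_m * 'rV[R]_n * R^o) : Prop :=
  (forall p, Omega p -> derivable G p e) /\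
  exists g : 'rV[R]_m * 'rV[R]_n * R^o -> R^o,
    {within closure Omega, continuous g} /\
    (forall p, Omega p -> g p = 'D_e G p).

(* The usual meaning of C^1(cl(Omega)) for [Omega] open. *)
Definition C1_closure (Omega : set ('rV[R]_m * 'rV[R]_n * R^o)) G : Prop :=
  [/\ {within closure Omega, continuous G},
      (forall i, C1_along Omega G (dirx i)),
      (forall j, C1_along Omega G (diry j))
    & C1_along Omega G dirz].

(* For [x] in the open set [X] this is the two-sided partial derivative even when
   [yz] is on the boundary of [Y `*` Z]: the other arguments stay fixed, and under
   [C1_closure] it exists and is the value of the continuous extension. *)
Definition Gx G x yz : 'rV[R]_m := \row_i 'D_(dirx i) G (x, yz.1, yz.2).

(* The target R^(m+1) is represented as R^m * R. *)
Definition GxG G x yz : 'rV[R]_m * R^o := (Gx G x yz, G (x, yz.1, yz.2)).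

Definition homeo_onto_range {T U : topologicalType} (A : set T) (f : T -> U) :=
  {within A, continuous f} /\
  exists g : U -> T,
    {within f @` A, continuous g} /\ (forall a, A a -> g (f a) = a).

(* [p] restricted to [0, 1] is t |-> (y_t, z_t) in the [G]-segment at [x0]. *)
Definition is_G_segment G Y Z x0 yz0 yz1 (p : R -> 'rV[R]_n * R^o) : Prop :=
  [/\ closure (Y `*` Z) yz0, closure (Y `*` Z) yz1 &
    forall t, t \in `[0, 1] ->
      closure (Y `*` Z) (p t) /\
      GxG G x0 (p t) = (1 - t) *: GxG G x0 yz0 + t *: GxG G x0 yz1].

Definition G_convex G X Y Z (u : 'rV[R]_m -> R^o) : Prop :=
  {within X, continuous u} /\
  forall x0, X x0 -> exists (y0 : 'rV[R]_n) (z0 : R^o),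
    [/\ closure Y y0, closure Z z0, u x0 = G (x0, y0, z0) &
      forall x, X x -> G (x, y0, z0) <= u x].

End GConvexity.

(* Main.v *)
(* Every slice [G (., y, z)] is [G]-convex.  If a combination [w] of two slices with
   supports on a [G]-segment at [x0] is [G]-convex, its own support at [x0] touches
   [w] from below at an interior point, so it has the same value and gradient as
   [w] there; injectivity of [(G_x, G)] then forces it to be the corresponding
   point of the segment, and the support inequality is convexity along the segment.
   Conversely, convexity along the segment joining the supports of [u0] and [u1] at
   [x0] says that the corresponding intermediate point supports the combination of
   [u0] and [u1]. *)
Require Import Defs.
From HB Require Import structures.
From mathcomp Require Import all_boot all_order all_algebra.
From mathcomp Require Import interval_inference ring lra.
From mathcomp Require Import all_classical all_reals all_analysis.

Set Implicit Arguments.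
Unset Strict Implicit.
Unset Printing Implicit Defensive.

Import Order.TTheory GRing.Theory Num.Theory.
Import numFieldNormedType.Exports.

Local Open Scope classical_set_scope.
Local Open Scope ring_scope.

(** * Closures of products, and derivatives up to the boundary *)

Lemma closure_setX (S T : topologicalType) (A : set S) (B : set T) :
  closure (A `*` B) = closure A `*` closure B.
Proof.
apply/seteqP; split=> [[a b] clab|[a b] /= [cla clb] U [[U1 U2] /= [a1 b2] sU]].
  split=> /= U nU.
    have : nbhs (a, b) (U `*` [set: T]).
      by exists (U, setT) => //; split => //; exact: filterT.
    by move=> /clab[[x y] [[/= Ax By] [/= Ux _]]]; exists x.
  have : nbhs (a, b) ([set: S] `*` U).
    by exists (setT, U) => //; split => //; exact: filterT.
  by move=> /clab[[x y] [[/= Ax By] [/= _ Uy]]]; exists y.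
have [x [Ax U1x]] := cla _ a1; have [y [By U2y]] := clb _ b2.
by exists (x, y); split => //; exact: sU.
Qed.

(** The two difference quotients coincide; this lets one-variable calculus act on directional
    derivatives. *)
Lemma is_derive_line (R : realType) (V : normedModType R) (f : V -> R^o)
    (a e : V) (s : R) (df : R^o) :
  is_derive (a + s *: e) e f df -> is_derive s 1 (fun t : R => f (a + t *: e)) df.
Proof.
have E : (fun h : R => h^-1 *: (f (a + (h *: (1 : R^o) + s) *: e) - f (a + s *: e)))
   = (fun h : R => h^-1 *: (f (h *: e + (a + s *: e)) - f (a + s *: e))).
  apply/funext => h; congr (_ *: (f _ - _)).
  by rewrite scalerDl [h *: 1]mulr1 addrCA.
move=> [fe dfe]; split; first by rewrite /derivable /= E.
by rewrite -dfe /derive /= E.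
Qed.

(** Needed because the increment [h] of a difference quotient may have either sign. *)
Lemma MVT_unordered (R : realType) (f df : R -> R) (a b : R) :
  (forall x, x \in `[Num.min a b, Num.max a b] -> is_derive x 1 f (df x)) ->
  exists2 c, c \in `[Num.min a b, Num.max a b] & f b - f a = df c * (b - a).
Proof.
wlog ab : a b / a <= b => [H|].
  have /orP[/H//|ba] := le_total a b.
  rewrite minC maxC => /(H _ _ ba)[c cab fab].
  by exists c => //; rewrite -opprB fab -mulrN opprB.
rewrite (min_l ab) (max_r ab) => fdf.
have fc : {within `[a, b], continuous f}.
  by apply: derivable_within_continuous => x /fdf[].
have fdo x : x \in `]a, b[ -> is_derive x 1 f (df x).
  by move=> /subset_itv_oo_cc /fdf.
by have /(_ fc) := MVT_segment ab fdo.
Qed.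

(* By the mean value theorem, [f (q + h e) - f q - h g p] is at most [eps |h|]
   for all [q] in [Omega] near [p] and all small [h]; letting [q] tend to [p]
   gives the same bound at [p]. *)
Lemma is_derive_closure (R : realType) (V : normedModType R) (Omega : set V)
    (f g : V -> R^o) (p e : V) (r : R) :
  0 < r -> closure Omega p ->
  {within closure Omega, continuous f} -> {within closure Omega, continuous g} ->
  (forall q, Omega q -> is_derive q e f (g q)) ->
  (\forall q \near p, Omega q -> forall h : R, `|h| < r -> Omega (q + h *: e)) ->
  is_derive p e f (g p).
Proof.
move=> r0 clp cf cg fg shift.
(* Limits run over points of [Omega] tending to [p], which may itself lie outside [Omega]; the
   filter is proper because [p] is in the closure. *)
pose F := within Omega (nbhs p).
have FF : ProperFilter F by exact: within_nbhs_proper.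
suff key : forall eps : R, 0 < eps -> \forall h \near (0 : R),
    `|f (h *: e + p) - f p - h *: g p| <= eps * `|h|.
  suff : (fun h : R => h^-1 *: (f (h *: e + p) - f p)) @ 0^' --> g p.
    move=> H; split; first by apply/cvg_ex; exists (g p).
    exact: cvg_lim.
  apply/cvgrPdist_le => eps eps0; near=> h.
  have h0 : h != 0 by near: h; exact: nbhs_dnbhs_neq.
  have H : `|f (h *: e + p) - f p - h *: g p| <= eps * `|h|.
    by near: h; apply: nbhs_dnbhs; exact: key.
  rewrite distrC -[X in _ - X](scalerK h0) -scalerBr normrZ normfV.
  by rewrite ler_pdivrMl ?normr_gt0// mulrC.
move=> eps eps0.
have shiftF : \forall q \near F, forall h : R, `|h| < r -> Omega (q + h *: e) by [].
have cvgshift : forall h : R, h *: e + q @[q --> F] --> h *: e + p.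
  move=> h; apply: cvgD; first exact: cvg_cst.
  exact: cvg_within.
have shiftcl : forall h : R, `|h| < r ->
    \forall q \near F, closure Omega (h *: e + q).
  move=> h hr; apply: filterS shiftF => q /(_ _ hr) Oq.
  by apply: subset_closure; rewrite addrC.
have cvgf : forall h : R, `|h| < r -> f (h *: e + q) @[q --> F] --> f (h *: e + p).
  move=> h hr.
  have clh : closure Omega (h *: e + p).
    by apply: closed_cvg (shiftcl _ hr) _ (cvgshift h); exact: closed_closure.
  have /(_ _ clh) := (subspace_continuousP (closure Omega) f).1 cf.
  apply: cvg_comp => A nA; have := cvgshift h _ nA.
  by apply: filterS2 (shiftcl _ hr) => q clq; exact.
(* Continuity of [g] at [p] is used jointly in [q] and [c]: a single [d] serves all [q] near [p], so
   the bound survives the limit in [q]. *)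
have [d [d0 gd]] : exists d : R, 0 < d /\ \forall q \near p, forall c : R,
    `|c| < d -> closure Omega (q + c *: e) -> `|g (q + c *: e) - g p| <= eps.
  have /(_ _ clp) := (subspace_continuousP (closure Omega) g).1 cg.
  move=> /cvgrPdist_le/(_ _ eps0); rewrite near_withinE => gp.
  have : (fun cq : R * V => cq.2 + cq.1 *: e) @ ((0 : R), p) --> p + (0 : R) *: e.
    by apply: cvgD; [exact: cvg_snd|apply: cvgZl; exact: cvg_fst].
  rewrite scale0r addr0 => /(_ _ gp)[[U1 U2] /= [nU1 nU2] U12].
  have [d /= d0 dU] := nU1.
  exists d; split => //; apply: filterS nU2 => q U2q c cd clqc.
  rewrite distrC; apply: (U12 (c, q)) => //; split => //=.
  by apply: dU; rewrite /= sub0r normrN.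
near=> h.
have hr : `|h| < r by near: h; exact: (@nbhs0_lt _ R^o).
have hd : `|h| < d by near: h; exact: (@nbhs0_lt _ R^o).
have fp : f q @[q --> F] --> f p.
  have := cvgf 0; rewrite normr0 scale0r add0r => /(_ r0).
  by under eq_fun do rewrite add0r.
have lim : `|f (h *: e + q) - f q - h *: g p| @[q --> F] -->
    `|f (h *: e + p) - f p - h *: g p|.
  apply: cvg_norm; apply: cvgB; last exact: cvg_cst.
  by apply: cvgB fp; exact: cvgf.
apply: (cvgr_to_le lim); near=> q.
have Oq : forall c : R, `|c| < r -> Omega (q + c *: e) by near: q; exact: shiftF.
have gq : forall c : R, `|c| < d -> closure Omega (q + c *: e) ->
    `|g (q + c *: e) - g p| <= eps.
  by near: q; exact: (cvg_within _ gd).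
have le_h c : c \in `[Num.min 0 h, Num.max 0 h] -> `|c| <= `|h|.
  rewrite in_itv /=; have /orP[h0|h0] := le_total 0 h.
    by rewrite min_l// max_r// => /andP[c0 ch]; rewrite !ger0_norm.
  by rewrite min_r// max_l// => /andP[hc c0]; rewrite !ler0_norm// lerN2.
have [c ch] : exists2 c : R, c \in `[Num.min 0 h, Num.max 0 h] &
    f (q + h *: e) - f (q + 0 *: e) = g (q + c *: e) * (h - 0).
  apply: (@MVT_unordered R (fun t : R => f (q + t *: e))
            (fun t : R => g (q + t *: e))) => c /le_h ch.
  by apply/is_derive_line/fg/Oq; exact: le_lt_trans hr.
rewrite subr0 scale0r addr0 [h *: e + q]addrC => ->.
rewrite [h *: g p]mulrC -mulrBl normrM ler_wpM2r//.
have {}ch := le_h _ ch.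
by apply: gq; [|apply/subset_closure/Oq]; exact: le_lt_trans ch _.
Unshelve. all: by end_near.
Qed.

(** Balls of row vectors are entrywise, and only the entry [i] moves, by [h]. *)
Lemma ball_add_delta_mx (R : realType) (m : nat) (x : 'rV[R]_m) (i : 'I_m) (h r : R) :
  `|h| < r -> ball x r (x + h *: delta_mx 0 i).
Proof.
move=> hr; split=> [|k l]; first exact: le_lt_trans hr.
rewrite /ball /= !mxE opprD addrA subrr sub0r normrN normrM.
by apply: le_lt_trans hr; rewrite ler_piMr// normr_nat; case: (_ && _).
Qed.

(** * The slices [G (., y, z)]: derivatives in [x] and contact from below *)

Section GSlices.
Context {R : realType} {m n : nat}.
Variables (X : set 'rV[R]_m) (Y : set 'rV[R]_n) (Z : set R^o).
Variable G : 'rV[R]_m * 'rV[R]_n * R^o -> R^o.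
Hypothesis oX : open X.
Hypothesis hG1 : C1_closure (X `*` Y `*` Z) G.

Let closure_XYZ x y z : X x -> closure (Y `*` Z) (y, z) ->
  closure (X `*` Y `*` Z) (x, y, z).
Proof.
rewrite !closure_setX => Xx [/= Yy Zz]; split => //; split => //.
exact: subset_closure.
Qed.

(** [(y, z)] may be a boundary point, but [dirx i] moves only [x], which is interior to [X], so
    [is_derive_closure] applies. *)
Lemma derivable_slice (i : 'I_m) x y z : X x -> closure (Y `*` Z) (y, z) ->
  derivable G (x, y, z) (dirx i).
Proof.
case: hG1 => cG /(_ i)[dG [g [cg gE]]] _ _ Xx clyz.
have /nbhs_ballP[r /= r0 rX] : nbhs x X by exact: open_nbhs_nbhs.
suff H : is_derive (x, y, z) (dirx i) G (g (x, y, z)) by case: H.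
(* One half of the radius is for the distance from [x] to the nearby point, the other for the shift
   by [h]. *)
have r20 : 0 < r / 2 by rewrite divr_gt0.
apply: (is_derive_closure r20 (closure_XYZ Xx clyz) cG cg).
  by move=> q Oq; split; [exact: dG|rewrite gE].
have : \forall q \near (x, y, z), ball x (r / 2) q.1.1.
  have /= := @cvg_comp _ _ _ fst fst _ _ _
    (@cvg_fst _ _ (nbhs (x, y)) (nbhs z) _)
    (@cvg_fst _ _ (nbhs x) (nbhs y) _).
  by apply; exact: nbhsx_ballx.
apply: filterS => -[[x' y'] z'] /= bx [[/= Xx' Yy'] Zz'] h hr.
rewrite /dirx; split; first split => /=.
- apply: rX; rewrite /= [r]splitr; apply: ball_triangle bx _.
  exact: ball_add_delta_mx.
- by rewrite scaler0 addr0.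
- by rewrite /= scaler0 addr0.
Qed.

(** At every [x0] the slice is its own support, with the same [(y, z)]. *)
Lemma G_convex_slice y z : closure (Y `*` Z) (y, z) ->
  G_convex G X Y Z (fun x => G (x, y, z)).
Proof.
move=> clyz; split.
  case: hG1 => cG _ _ _; apply/subspace_continuousP => x Xx.
  have /(_ _ (closure_XYZ Xx clyz)) := (subspace_continuousP _ G).1 cG.
  apply: cvg_comp => A /= nA.
  have [[U1 U2] /= [[[V1 V2] /= [nV1 nV2] sV] nU2] sU] := nA.
  apply: filterS nV1 => q V1q Xq; apply: (sU (q, y, z)); last exact: closure_XYZ.
  split; last exact: nbhs_singleton.
  by apply: sV; split => //; exact: nbhs_singleton.
by move=> x0 Xx0; exists y, z; move: clyz; rewrite closure_setX => -[].
Qed.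

(* The combination on the right of the inequality touches its support [G (., y, z)] at an
   interior point, so their partial derivatives agree there. *)
Lemma GxG_support (x : 'rV[R]_m) yz yz0 yz1 (a b : R) :
  X x -> closure (Y `*` Z) yz -> closure (Y `*` Z) yz0 -> closure (Y `*` Z) yz1 ->
  G (x, yz.1, yz.2) = a * G (x, yz0.1, yz0.2) + b * G (x, yz1.1, yz1.2) ->
  (forall x', X x' -> G (x', yz.1, yz.2) <=
     a * G (x', yz0.1, yz0.2) + b * G (x', yz1.1, yz1.2)) ->
  GxG G x yz = a *: GxG G x yz0 + b *: GxG G x yz1.
Proof.
case: yz yz0 yz1 => [y z] [y0 z0] [y1 z1] Xx cl cl0 cl1 /= eqx lex.
apply/pair_equal_spec; split => //=; apply/rowP => i; rewrite !mxE /=.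
have line y' z' t : ((x, y', z') : 'rV[R]_m * 'rV[R]_n * R^o) + t *: dirx i
    = (x + t *: delta_mx 0 i, y', z').
  apply/pair_equal_spec; split; last by rewrite /= scaler0 addr0.
  by apply/pair_equal_spec; split; rewrite //= scaler0 addr0.
have /nbhs_ballP[r /= r0 rX] : nbhs x X by exact: open_nbhs_nbhs.
have lineX (t : R) : t \in `]-r, r[ -> X (x + t *: delta_mx 0 i).
  rewrite in_itv /= => tr; apply: rX; apply: ball_add_delta_mx.
  by rewrite ltr_norml.
have dline y' z' (t : R) : t \in `]-r, r[ -> closure (Y `*` Z) (y', z') ->
    is_derive t 1 (fun t : R => G (x + t *: delta_mx 0 i, y', z'))
      ('D_(dirx i) G (x + t *: delta_mx 0 i, y', z')).
  move=> tr cl'; under eq_fun do rewrite -line; apply: is_derive_line.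
  by rewrite line; apply: DeriveDef => //; apply: derivable_slice => //; exact: lineX.
(* The gap along the [i]-th coordinate line is nonnegative and vanishes at [t = 0], so its
   derivative there is zero. *)
pose f (t : R) : R := a *: G (x + t *: delta_mx 0 i, y0, z0)
  + b *: G (x + t *: delta_mx 0 i, y1, z1) - G (x + t *: delta_mx 0 i, y, z).
have fd (t : R) : t \in `]-r, r[ -> is_derive t 1 f
   (a *: 'D_(dirx i) G (x + t *: delta_mx 0 i, y0, z0)
  + b *: 'D_(dirx i) G (x + t *: delta_mx 0 i, y1, z1)
   - 'D_(dirx i) G (x + t *: delta_mx 0 i, y, z)).
  move=> tr; apply: is_deriveB; last exact: dline.
  by apply: is_deriveD; apply: is_deriveZ; exact: dline.
have r00 : 0 \in `]-r, r[ by rewrite in_itv /= oppr_lt0 r0.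
have f0 : is_derive (0 : R) 1 f 0.
  apply: (@derive1_at_min _ _ (- r) r) => //.
  - by rewrite ge0_cp// ltW.
  - by move=> t /fd[].
  - move=> t tr; rewrite /f scale0r addr0 -eqx subrr subr_ge0.
    by apply: lex; exact: lineX.
have := @derive_val _ _ _ _ _ _ _ (fd _ r00).
rewrite (@derive_val _ _ _ _ _ _ _ f0) scale0r addr0 => /esym/eqP.
by rewrite subr_eq0 => /eqP/esym.
Qed.

End GSlices.

(** * Convex combinations of segment parameters, and the two implications *)

Lemma conv_itv01 (R : realType) (a s t : R) : a \in `[0, 1] ->
  s \in `[0, 1] -> t \in `[0, 1] -> a * s + (1 - a) * t \in `[0, 1].
Proof.
rewrite !in_itv /= => /andP[a0 a1] /andP[s0 s1] /andP[t0 t1].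
by apply/andP; split; nra.
Qed.

(** A segment is affine in its parameter, so combining two of its points combines their
    parameters. *)
Lemma conv_affine (R : realType) (V : lmodType R) (a s t : R) (u v : V) :
  a *: ((1 - s) *: u + s *: v) + (1 - a) *: ((1 - t) *: u + t *: v) =
  (1 - (a * s + (1 - a) * t)) *: u + (a * s + (1 - a) * t) *: v.
Proof.
by rewrite !scalerDr !scalerA addrACA -!scalerDl; congr (_ *: _ + _); ring.
Qed.

Theorem theorem4p1 (R : realType) (m n : nat) (hmn : (n <= m)%N)
    (X : set 'rV[R]_m) (Y : set 'rV[R]_n) (zl : R) (zu : \bar R)
    (oX : open X) (bX : bounded_set X) (oY : open Y) (bY : bounded_set Y)
    (hz : (zl%:E < zu)%E)
    (G : 'rV[R]_m * 'rV[R]_n * R^o -> R^o)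
    (hG1 : C1_closure (X `*` Y `*` Zitv zl zu) G)
    (hGhomeo : forall x, X x -> homeo_onto_range (closure (Y `*` Zitv zl zu)) (GxG G x))
    (hGconv : forall x, X x -> convex_set (GxG G x @` closure (Y `*` Zitv zl zu))) :
  convex_set [set u : 'rV[R]_m -> R^o | G_convex G X Y (Zitv zl zu) u] <->
  (forall x x0, X x -> X x0 ->
     forall yz0 yz1 (p : R -> 'rV[R]_n * R^o),
       is_G_segment G Y (Zitv zl zu) x0 yz0 yz1 p ->
       convex_function (`[0, 1]%classic : set R^o)
         (fun t => G (x, (p t).1, (p t).2))).
Proof.
set Z := Zitv zl zu in hG1 hGhomeo hGconv *.
have GxG_inj x yz yz' : X x -> closure (Y `*` Z) yz -> closure (Y `*` Z) yz' ->
    GxG G x yz = GxG G x yz' -> yz = yz'.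
  by move=> /hGhomeo[_ [g [_ gK]]] cl cl' e; rewrite -(gK _ cl) e gK.
split=> [Uconv x x0 Xx Xx0 yz0 yz1 p [cl0 cl1 seg] k s s' s01 s'01|segconv].
  have [cls segs] := seg s (set_mem s01).
  have [cls' segs'] := seg s' (set_mem s'01).
  have slice t : closure (Y `*` Z) (p t) ->
      (fun x => G (x, (p t).1, (p t).2)) \in [set u | G_convex G X Y Z u].
    by move=> clt; apply/mem_set/G_convex_slice => //; rewrite -surjective_pairing.
  have := set_mem (Uconv _ _ k (slice _ cls) (slice _ cls')).
  move=> [_ /(_ x0 Xx0)[y [z [cly clz ux0 uge]]]].
  have clyz : closure (Y `*` Z) (y, z) by rewrite closure_setX.
  pose t : R := k%:num * (s : R) + (1 - k%:num) * (s' : R).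
  have k01 : k%:num \in `[0, 1] by rewrite in_itv /=; apply/andP.
  have [clt segt] := seg t (conv_itv01 k01 (set_mem s01) (set_mem s'01)).
  have yzE : (y, z) = p t.
    apply: (GxG_inj _ _ _ Xx0) => //.
    rewrite (GxG_support oX hG1 Xx0 clyz cls cls' (esym ux0) uge) segs segs' segt.
    exact: conv_affine.
  (* Once [(y, z)] is known to be [p t], the support inequality at [x] is the convexity
     inequality. *)
  by have := uge _ Xx; rewrite -[y]/((y, z).1) -[X in G (_, _, X)]/((y, z).2) yzE.
move=> u0 u1 k /set_mem[cu0 su0] /set_mem[cu1 su1]; apply/mem_set; split.
  apply/subspace_continuousP => x Xx.
  have /(_ _ Xx) := (subspace_continuousP _ u0).1 cu0.
  have /(_ _ Xx) := (subspace_continuousP _ u1).1 cu1.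
  by move=> c1 c0; apply: cvgD; apply: cvgZr.
move=> x0 Xx0.
have [y0 [z0 [cly0 clz0 u0x0 u0ge]]] := su0 _ Xx0.
have [y1 [z1 [cly1 clz1 u1x0 u1ge]]] := su1 _ Xx0.
have cl0 : closure (Y `*` Z) (y0, z0) by rewrite closure_setX.
have cl1 : closure (Y `*` Z) (y1, z1) by rewrite closure_setX.
(* Keeping the membership of [t] under the existential lets choice return a total [p]; outside
   [[0, 1]] the witness [(y0, z0)] is arbitrary. *)
have seg (t : R) : exists yz, t \in `[0, 1] -> closure (Y `*` Z) yz /\
   GxG G x0 yz = (1 - t) *: GxG G x0 (y0, z0) + t *: GxG G x0 (y1, z1).
  have [|] := boolP (t \in `[0, 1]); last by exists (y0, z0).
  rewrite in_itv /= => /andP[t0 t1].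
  (* The endpoints are swapped: the library's combination puts the weight [t] on its first point, a
     segment on its second. *)
  have := hGconv _ Xx0 _ _ (Itv01 t0 t1)
    (mem_set (imageP _ cl1)) (mem_set (imageP _ cl0)).
  by move=> /set_mem[yz clyz yzE]; exists yz; rewrite yzE addrC.
have [p pP] := choice seg.
have segp : is_G_segment G Y Z x0 (y0, z0) (y1, z1) p by split.
have i0 : (0 : R) \in `[0, 1] by rewrite in_itv /= lexx ler01.
have i1 : (1 : R) \in `[0, 1] by rewrite in_itv /= lexx ler01.
(* Choice fixes [p] only through its image under [GxG]; injectivity recovers the endpoints. *)
have p0 : p 0 = (y0, z0).
  have [cl e] := pP _ i0; apply: (GxG_inj _ _ _ Xx0) => //.
  by rewrite e subr0 scale1r scale0r addr0.
have p1 : p 1 = (y1, z1).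
  have [cl e] := pP _ i1; apply: (GxG_inj _ _ _ Xx0) => //.
  by rewrite e subrr scale1r scale0r add0r.
(* The weight [k] falls on [u0], supported at parameter 0, so the combination is supported at
   parameter [1 - k]. *)
have tE : k%:num * 0 + (1 - k%:num) * 1 = 1 - k%:num by rewrite mulr0 add0r mulr1.
have t01 : 1 - k%:num \in `[0, 1].
  by rewrite in_itv /= subr_ge0 gerBl; apply/andP.
have [clt et] := pP _ t01.
exists (p (1 - k%:num)).1, (p (1 - k%:num)).2.
move: (clt); rewrite closure_setX => -[cly clz]; split => //.
  have /= -> := congr1 snd et.
  by rewrite subKr -u0x0 -u1x0.
move=> x Xx.
have := segconv x x0 Xx Xx0 _ _ p segp k 0 1 (mem_set i0) (mem_set i1).
rewrite p0 p1 [X in p X](tE : _ = 1 - k%:num) /= => /le_trans; apply.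
by apply: lerD; rewrite ler_wpM2l ?subr_ge0 //; [exact: u0ge|exact: u1ge].
Qed.
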